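(* Let $S$ be a countable set and let $\leq_S$ be a partial order on $S$. Then there exist families $(\mathcal L_s)_{s\in S}$ and $(\mathcal K_s)_{s\in S}$ of sets of languages over the alphabet $\{1,2\}$ such that for all $s,t\in S$: (1) $\mathcal L(\mathcal K_s)\leq_{expr}\mathcal L(\mathcal K_t)$ if and only if $\mathcal L(\mathcal L_s)\leq_{poly}\mathcal L(\mathcal L_t)$ if and only if $s\leq_S t$; (2) all logics $\mathcal L(\mathcal L_s)$, $s\in S$, are equally expressive, and if $s\not\leq_S t$, then $\mathcal L(\mathcal L_s)$ is exponentially more succinct than $\mathcal L(\mathcal L_t)$.
   Context: Fix an infinite set $P$ of propositional variables. A Kripke model with $n$ modalities is $M=(W,R_1,\dots,R_n,\Pi)$ with $W\neq\emptyset$, $R_j\subseteq W\times W$, $\Pi\colon P\to2^W$; a pointed model is $(M,w)$ with $w\in W$. A successor selection function $O$ assigns to each pointed model $(M,w)$ a set $O(M,w)\subseteq W$. For a set $\mathcal O$ of such functions, $\mathcal L(\mathcal O)$ has formulas $\varphi::=p\mid\neg\varphi\mid\varphi\vee\varphi\mid[O]\varphi$ ($p\in P$, $O\in\mathcal O$), with usual semantics and $M,w\models[O]\varphi$ iff $M,w'\models\varphi$ for all $w'\in O(M,w)$. $|\varphi|$ is the number of nodes of the syntax tree of $\varphi$; formulas are equivalent if satisfied by the same pointed models. For a word $s=s_1\dots s_l\in\{1,\dots,n\}^*$, $w'$ is an $s$-successor of $w$ in $M$ if there are worlds $w=w_0,w_1,\dots,w_l=w'$ with $(w_{k-1},w_k)\in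 R_{s_k}$ for all $k$. A language $L\subseteq\{1,\dots,n\}^*$ defines $O_L(M,w)=\{w' : w'$ is an $s$-successor of $w$ for some $s\in L\}$; for a set $\mathcal L$ of languages, $\mathcal L(\mathcal L)$ denotes $\mathcal L(\{O_L:L\in\mathcal L\})$. Here $n=2$ (bimodal models). For logics $\mathcal L_1,\mathcal L_2$: $\mathcal L_1\leq_{expr}\mathcal L_2$ if every $\mathcal L_1$-formula has an equivalent $\mathcal L_2$-formula; $\mathcal L_1\leq_{poly}\mathcal L_2$ if there is a fixed polynomial $q$ such that every $\mathcal L_1$-formula $\varphi$ has an equivalent $\mathcal L_2$-formula $\psi$ with $|\psi|\le q(|\varphi|)$. They are equally expressive if $\leq_{expr}$ holds in both directions. If equally expressive, $\mathcal L_1$ is exponentially more succinct than $\mathcal L_2$ if there is a sequence $(\varphi_i)_{i\in\mathbb N}$ of $\mathcal L_1$-formulas with $|\varphi_i|$ linear in $i$ and a constant $c>1$ such that every $\mathcal L_2$-formula equivalent to $\varphi_i$ has size at least $c^i$. *)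

(* Defs.v *)
From HB Require Import structures.
From mathcomp Require Import all_boot all_order all_algebra.
From mathcomp Require Import boolp classical_sets cardinality reals.
From Stdlib Require Import Relation_Definitions.

Set Implicit Arguments.
Unset Strict Implicit.
Unset Printing Implicit Defensive.

Import Order.TTheory GRing.Theory Num.Theory.

Local Open Scope classical_set_scope.
Local Open Scope ring_scope.

Record kripke (n : nat) (P : Type) := Kripke {
  world : Type;
  world_nonempty : inhabited world;
  acc : 'I_n -> world -> world -> Prop;
  val_of : P -> set world
}.
Arguments val_of {n P} k p.

Definition selector (n : nat) (P : Type) :=
  forall M : kripke n P, world M -> set (world M).

(* Formulas over all successor selection functions; the language of a
   particular logic is singled out by [logic] below, so that formulas of
   different logics can be compared directly. *)
Inductive formula (n : nat) (P : Type) :=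
| Var of P
| Neg of formula n P
| Or of formula n P & formula n P
| Box of selector n P & formula n P.

Fixpoint fsize (n : nat) (P : Type) (phi : formula n P) : nat :=
  match phi with
  | Var _ => 1%N
  | Neg f => (fsize f).+1
  | Or f g => (fsize f + fsize g).+1%N
  | Box _ f => (fsize f).+1
  end.

Fixpoint sat (n : nat) (P : Type) (M : kripke n P) (w : world M)
    (phi : formula n P) : Prop :=
  match phi with
  | Var p => val_of M p w
  | Neg f => ~ sat w f
  | Or f g => sat w f \/ sat w g
  | Box sel f => forall w', sel M w w' -> sat w' f
  end.

Fixpoint logic (n : nat) (P : Type) (Os : set (selector n P))
    (phi : formula n P) : Prop :=
  match phi with
  | Var _ => True
  | Neg f => logic Os f
  | Or f g => logic Os f /\ logic Os g
  | Box sel f => Os sel /\ logic Os f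
  end.

Definition equivalent (n : nat) (P : Type) (phi psi : formula n P) :=
  forall (M : kripke n P) (w : world M), sat w phi <-> sat w psi.

(* The letters 1, ..., n are represented by 0, ..., n - 1 in 'I_n. *)
Definition language (n : nat) := set (seq 'I_n).

(* The worlds w_0, ..., w_l are v 0, ..., v l with l = size s; the values of
   v beyond l are irrelevant. *)
Definition word_successor (n : nat) (P : Type) (M : kripke n P)
    (s : seq 'I_n) (w w' : world M) :=
  exists v : nat -> world M,
    [/\ v 0%N = w, v (size s) = w' &
        forall k : 'I_(size s), acc (tnth (in_tuple s) k) (v k) (v k.+1)].

Definition lang_selector (n : nat) (P : Type) (L : language n) :
    selector n P :=
  fun M w => [set w' | exists2 s, L s & word_successor s w w'].

Definition lang_logic (n : nat) (P : Type) (LL : set (language n)) :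
    set (formula n P) :=
  logic (@lang_selector n P @` LL).
Arguments lang_logic {n} P LL.

Definition leq_expr (n : nat) (P : Type) (L1 L2 : set (formula n P)) :=
  forall phi, L1 phi -> exists2 psi, L2 psi & equivalent phi psi.

Definition leq_poly (R : realType) (n : nat) (P : Type)
    (L1 L2 : set (formula n P)) :=
  exists q : {poly R}, forall phi, L1 phi ->
    exists psi, [/\ L2 psi, equivalent phi psi &
                    (fsize psi)%:R <= q.[(fsize phi)%:R]].

Definition equally_expressive (n : nat) (P : Type)
    (L1 L2 : set (formula n P)) :=
  leq_expr L1 L2 /\ leq_expr L2 L1.

Definition linear_growth (f : nat -> nat) :=
  exists a : nat, forall i : nat, (i <= a * f i)%N /\ (f i <= a * i.+1)%N.

Definition exp_more_succinct (R : realType) (n : nat) (P : Type)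
    (L1 L2 : set (formula n P)) :=
  equally_expressive L1 L2 /\
  exists phi : nat -> formula n P,
    [/\ forall i, L1 (phi i),
        linear_growth (fun i => fsize (phi i)) &
        exists c : R, 1 < c /\
          forall (i : nat) (psi : formula n P), L2 psi ->
            equivalent (phi i) psi -> c ^+ i <= (fsize psi)%:R].

(* Main.v *)
Require Import Defs.
From HB Require Import structures.
From mathcomp Require Import all_boot all_order all_algebra.
From mathcomp Require Import boolp classical_sets cardinality reals.
From Stdlib Require Import Relation_Definitions.

Set Implicit Arguments.
Unset Strict Implicit.
Unset Printing Implicit Defensive.

Import Order.TTheory GRing.Theory Num.Theory.

Local Open Scope classical_set_scope.

(* Let [v u j] be the word [(1^u 2)^(2^(j+1))]; the word [v u j] is a factor of
   [v t i] only if [u = t]. Identify [S] with a subset of [nat], let [KK s]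
   consist of the singleton languages [{v t j}] with [t <= s], and let [LL s]
   add the one-letter languages [{1}] and [{2}] to [KK s]. With the two letters
   all words are expressible, so all [LL s] have the expressive power of
   bimodal logic. On the path labelled by a word [w], a formula equivalent to
   [[w]p] must contain a chain of nested boxes reaching the end of the path,
   so [w] is a concatenation of fewer words than the size of the formula. If
   [s <= t] fails, no word of [KK t] is a factor of [v s i]; hence [[v s i]p]
   is not expressible over [KK t], and over [LL t] it has to be spelled letter
   by letter, at cost at least [2^i]. *)

(** * Successors along a word, and path models *)

Lemma word_successor_nil n P (M : kripke n P) (w w' : world M) :
  word_successor [::] w w' <-> w = w'.
Proof.
split=> [[v [<- <- _]] //|<-].
by exists (fun=> w); split=> // -[].
Qed.

Lemma word_successor_cons n P (M : kripke n P) a s (w w' : world M) :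
  word_successor (a :: s) w w' <->
  exists2 u, acc a w u & word_successor s u w'.
Proof.
split=> [[v [v0 vs vacc]]|[u wu [v [v0 vs vacc]]]].
- exists (v 1%N); first by have := vacc ord0; rewrite (tnth_nth a) /= v0.
  exists (fun k => v k.+1); split=> // k.
  by have := vacc (lift ord0 k); rewrite !(tnth_nth a) /=.
- exists (fun k => if k is k'.+1 then v k' else w); split=> //.
  case=> -[|k] kP; first by rewrite (tnth_nth a) /= v0.
  have kP' : (k < size s)%N by [].
  by have := vacc (Ordinal kP'); rewrite !(tnth_nth a) /=.
Qed.

(** Worlds beyond [size w] are isolated. The guard [x < size w] matters because the default value of
    [nth] is the letter [a] itself. *)
Definition path_model n P (w : seq 'I_n) (V : P -> set nat) : kripke n P :=
  @Kripke n P nat (inhabits 0%N)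
    (fun a x y => [/\ (x < size w)%N, nth a w x = a & y = x.+1]) V.

Lemma word_successor_path n P (w : seq 'I_n) (V : P -> set nat) s
    (x y : world (path_model w V)) :
  (x <= size w)%N -> word_successor s x y ->
  (y <= size w)%N /\ drop x w = s ++ drop y w.
Proof.
elim: s x => [|a s IH] x xw; first by move=> /word_successor_nil <-.
move=> /word_successor_cons[_ [xlt wa ->]] /(IH _ xlt)[yw e].
by rewrite (drop_nth a xlt) wa e.
Qed.

Lemma path_word_successor n P (w : seq 'I_n) (V : P -> set nat) :
  @word_successor n P (path_model w V) w 0%N (size w).
Proof.
exists id; split=> // k; split=> //.
by rewrite [RHS](tnth_nth (tnth (in_tuple w) k)).
Qed.

(* The valuations differ at most at the last world of the path, so only a chain
   of boxes leading there can tell the two models apart. *)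
Lemma path_indistinguishable n P (LL : set (language n)) (w : seq 'I_n)
    (V V' : P -> set nat) :
    (forall p x, (x < size w)%N -> V p x <-> V' p x) ->
  forall psi, lang_logic P LL psi -> forall x, (x <= size w)%N ->
    (@sat n P (path_model w V) x psi <-> @sat n P (path_model w V') x psi) \/
    exists ws, [/\ (forall s, s \in ws -> exists2 L, LL L & L s),
                   flatten ws = drop x w & (size ws < fsize psi)%N].
Proof.
move=> VV'; elim=> [p|f IH|f IHf g IHg|sel f IH] /=.
- move=> _ x; rewrite leq_eqVlt => /orP[/eqP ->|xw]; last by left; exact: VV'.
  by right; exists [::]; rewrite drop_size.
- move=> lf x xw; have [e|[ws [h1 h2 h3]]] := IH lf x xw; first by left; rewrite e.
  by right; exists ws; split=> //; exact: ltnW.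
- move=> [lf lg] x xw.
  have [ef|[ws [h1 h2 h3]]] := IHf lf x xw; last first.
    right; exists ws; split=> //; apply: (leq_trans h3).
    by rewrite -addnS leq_addr.
  have [eg|[ws [h1 h2 h3]]] := IHg lg x xw; last first.
    right; exists ws; split=> //; apply: (leq_trans h3).
    by rewrite -addSn leq_addl.
  by left; rewrite ef eg.
- move=> [[L LLL <-] lf] x xw.
  (* If no such chain starts at [x], no shorter one starts at a successor [y], since the word [s]
     leading to [y] would prolong it. The induction hypothesis then gives agreement at every [y]. *)
  have [[ws wsP]|nws] := pselect (exists ws,
    [/\ (forall s, s \in ws -> exists2 L, LL L & L s),
        flatten ws = drop x w & (size ws < (fsize f).+1)%N]).
    by right; exists ws.
  left; suff key y : lang_selector (M := path_model w V) L x y ->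
      (@sat n P (path_model w V) y f <-> @sat n P (path_model w V') y f).
    by split=> h y Hy; apply/key => //; apply: h.
  move=> [s Ls /(word_successor_path xw)[yw e]].
  have [//|[ws [h1 h2 h3]]] := IH lf y yw.
  case: nws; exists (s :: ws); split=> [r| |]; last by [].
    by rewrite inE => /orP[/eqP ->|/h1 //]; exists L.
  by rewrite /= h2.
Qed.

(** * Boxes over a single word *)

Definition word_box n P (w : seq 'I_n) (f : formula n P) : formula n P :=
  Box (lang_selector (P := P) [set w]) f.

Lemma sat_word_box n P (M : kripke n P) (x : world M) w f :
  sat x (word_box w f) <-> forall y, word_successor w x y -> sat y f.
Proof.
split=> h y; first by move=> xy; apply: h; exists w.
by case=> _ -> xy; exact: h.
Qed.

(** At the start of the path labelled by [w], the box holds when [p] is true exactly at the last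
    world and fails when [p] is true nowhere. An equivalent [psi] has to separate these two models
    as well. *)
Lemma word_box_factorization n P (LL : set (language n)) w (p : P) psi :
    lang_logic P LL psi -> equivalent (word_box w (Var n p)) psi ->
  exists ws, [/\ (forall s, s \in ws -> exists2 L, LL L & L s),
                 flatten ws = w & (size ws < fsize psi)%N].
Proof.
move=> lpsi eqv.
pose V (_ : P) := [set x : nat | x = size w]; pose V' (_ : P) : set nat := set0.
have VV' q x : (x < size w)%N -> V q x <-> V' q x.
  by move=> xw; split=> // xe; move: xw; rewrite xe ltnn.
have [e|[ws [h1 h2 h3]]] := path_indistinguishable VV' lpsi (leq0n _); last first.
  by exists ws; rewrite h2 drop0.
have : @sat n P (path_model w V') 0%N psi.
  apply/e/(eqv (path_model w V) 0%N)/sat_word_box => y.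
  move=> /(word_successor_path (leq0n _))[yw /(congr1 size)].
  rewrite drop0 size_cat size_drop => /eqP.
  rewrite -[X in X == _]addn0 eqn_add2l eq_sym subn_eq0 => wy.
  by apply/eqP; rewrite eqn_leq yw.
move=> /(eqv (path_model w V') 0%N)/sat_word_box/(_ _ (path_word_successor _ _)).
by [].
Qed.

Lemma logic_word_box n P (LL : set (language n)) w (f : formula n P) :
  LL [set w] -> lang_logic P LL f -> lang_logic P LL (word_box w f).
Proof. by move=> LLw lf; split=> //; exists [set w]. Qed.

Lemma lang_logic_sub n P (L1 L2 : set (language n)) :
  L1 `<=` L2 -> lang_logic P L1 `<=` lang_logic P L2.
Proof.
move=> L12; elim=> //= [f IHf g IHg [/IHf lf /IHg lg] //|sel f IH].
by move=> [[L L1L <-] /IH lf]; split=> //; exists L => //; exact: L12.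
Qed.

Lemma leq_expr_sub n P (L1 L2 : set (formula n P)) :
  L1 `<=` L2 -> leq_expr L1 L2.
Proof. by move=> L12 f /L12 lf; exists f. Qed.

Lemma leq_poly_sub (R : realType) n P (L1 L2 : set (formula n P)) :
  L1 `<=` L2 -> leq_poly R L1 L2.
Proof.
move=> L12; exists 'X%R => f /L12 lf.
by exists f; split=> //; rewrite hornerX.
Qed.

(** A box over a word unfolds into nested boxes over its letters. The size may grow without bound,
    as a long word costs only one box before unfolding. *)
Lemma leq_expr_letters n P (L1 L2 : set (language n)) :
    (forall L, L1 L -> exists w, L = [set w]) -> (forall a, L2 [set [:: a]]) ->
  leq_expr (lang_logic P L1) (lang_logic P L2).
Proof.
move=> L1w L2a; elim=> [p|f IH|f IHf g IHg|sel f IH].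
- by move=> _; exists (Var n p).
- by move=> /IH[f' lf' e]; exists (Neg f') => // M x /=; rewrite (e M x).
- move=> [/IHf[f' lf' ef] /IHg[g' lg' eg]].
  by exists (Or f' g') => // M x /=; rewrite (ef M x) (eg M x).
- move=> [[L /L1w[w ->] <-] /IH[f' lf' e]].
  exists (foldr (fun a => word_box [:: a]) f' w).
    by elim: w => //= a w IHw; exact: logic_word_box.
  move=> M x; elim: w x => [|a w IHw] x.
    rewrite -[X in X <-> _]/(sat x (word_box [::] f)) sat_word_box /= -(e M x).
    by split=> [|h y /word_successor_nil <- //]; apply; exact/word_successor_nil.
  rewrite -[X in X <-> _]/(sat x (word_box (a :: w) f)) sat_word_box [foldr _ _ _]/=.
  rewrite sat_word_box; split=> [h y /word_successor_cons[z xz /word_successor_nil <-]|].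
    by apply/IHw/sat_word_box => u zu; apply/h/word_successor_cons; exists z.
  move=> h y /word_successor_cons[z xz zy].
  have /IHw/sat_word_box : sat z (foldr (fun a => word_box [:: a]) f' w).
    by apply/h/word_successor_cons; exists z => //; exact/word_successor_nil.
  exact.
Qed.

(** * Periodic words and their factors *)

(** This is [v u j], with [ord0] for the letter 1 and [ord_max] for 2. The exponent [j.+1] ensures
    at least two periods even for [j = 0]. *)
Definition power_word (u j : nat) : seq 'I_2 :=
  mkseq (fun k => if (u.+1 %| k.+1)%N then ord_max else ord0)
        (2 ^ j.+1 * u.+1).

Lemma size_power_word u j : size (power_word u j) = (2 ^ j.+1 * u.+1)%N.
Proof. exact: size_mkseq. Qed.

Lemma nth_power_word u j k : (k < size (power_word u j))%N ->
  (nth ord0 (power_word u j) k == ord_max) = (u.+1 %| k.+1)%N.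
Proof.
rewrite size_power_word => kj; rewrite nth_mkseq //.
by case: (_ %| _)%N.
Qed.

(** The first two letters 2 of the factor are [u.+1] apart, so [t.+1] divides [u.+1]. Hence
    [t.+1 <= u.+1], and the letter 2 of the outer word that comes [t.+1] places after the first of
    them still lies in the factor, so [u.+1] divides [t.+1]. *)
Lemma infix_power_word u j t i : infix (power_word u j) (power_word t i) -> u = t.
Proof.
move=> /infixP[a [b e]].
have two_le : (u.+1 + u.+1 <= size (power_word u j))%N.
  by rewrite addnn -mul2n size_power_word leq_mul2r /= expnS leq_pmulr ?expn_gt0.
have shift k : (k < size (power_word u j))%N ->
    (t.+1 %| (size a + k).+1)%N = (u.+1 %| k.+1)%N.
  move=> ku; rewrite -(nth_power_word ku) -(@nth_power_word t i); last first.
    by rewrite e !size_cat ltn_add2l (leq_trans ku) // leq_addr.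
  by rewrite e nth_cat ltnNge leq_addr /= addKn nth_cat ku.
have d1 : (t.+1 %| size a + u.+1)%N.
  by rewrite addnS shift ?dvdnn //; apply: leq_trans two_le; rewrite leq_addr.
have d2 : (t.+1 %| u.+1)%N.
  rewrite -(dvdn_addr _ d1) -addnA addnS addnS shift -?addnS ?dvdn_addr //.
have tu := dvdn_leq (ltn0Sn u) d2.
have d3 : (u.+1 %| t.+1)%N.
  rewrite -(dvdn_addr _ (dvdnn u.+1)) addnS -shift -?addnS.
    by rewrite addnA dvdn_addr.
  by apply: leq_trans two_le; rewrite leq_add2l.
by apply/eqP; rewrite -eqSS eqn_dvd d3 d2.
Qed.

Lemma infix_flatten (T : eqType) (s : seq T) ss : s \in ss -> infix s (flatten ss).
Proof.
elim: ss => //= r ss IH; rewrite inE => /orP[/eqP ->|/IH sss].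
  exact: prefix_infix.
exact: infix_catl.
Qed.

(** Pairs of negations serve as padding: [linear_growth] also bounds sizes from below, while a box
    over a word applied to a variable always has size 2. *)
Lemma iter_double_neg n P (M : kripke n P) (x : world M) k f :
  sat x (iter k.*2 (@Neg n P) f) <-> sat x f.
Proof. by elim: k => //= k <-; rewrite notK. Qed.

Lemma fsize_iter_neg n P k (f : formula n P) :
  fsize (iter k (@Neg n P) f) = (k + fsize f)%N.
Proof. by elim: k => //= k ->. Qed.

Lemma logic_iter_neg n P k (Os : set (selector n P)) f :
  logic Os (iter k (@Neg n P) f) = logic Os f.
Proof. by elim: k => //= k ->. Qed.

(** * The two families of logics *)

Section Families.

Variables (S : Type) (leS : S -> S -> Prop) (code : S -> nat).
Hypothesis code_inj : injective code.

Definition power_langs (s : S) : set (language 2) :=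
  [set L | exists t j, leS t s /\ L = [set power_word (code t) j]].

Definition letter_power_langs (s : S) : set (language 2) :=
  [set L | (exists a, L = [set [:: a]]) \/ power_langs s L].

Lemma infix_power_langs s t i L w : ~ leS s t ->
  power_langs t L -> L w -> ~~ infix w (power_word (code s) i).
Proof.
move=> nst [u [j [ut ->]]] ->; apply/negP => /infix_power_word /code_inj us.
by apply: nst; rewrite -us.
Qed.

Lemma power_langs_inexpressible P s t i (p : P) psi : ~ leS s t ->
  lang_logic P (power_langs t) psi ->
  ~ equivalent (word_box (power_word (code s) i) (Var 2 p)) psi.
Proof.
move=> nst lpsi /(word_box_factorization lpsi)[ws [wsP e _]].
(* A power word is nonempty, so the factorization has a first word, which would be a factor from
   [power_langs t]. *)
case: ws e wsP => [/(congr1 size)|w ws e /(_ w (mem_head _ _))[L tL Lw]].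
  by move=> /esym/eqP; rewrite size_power_word muln_eq0 expn_eq0.
have := infix_power_langs i nst tL Lw.
by rewrite -e infix_flatten // mem_head.
Qed.

Lemma letter_power_langs_size P s t i (p : P) psi : ~ leS s t ->
  lang_logic P (letter_power_langs t) psi ->
  equivalent (word_box (power_word (code s) i) (Var 2 p)) psi ->
  (2 ^ i <= fsize psi)%N.
Proof.
move=> nst lpsi /(word_box_factorization lpsi)[ws [wsP e wssize]].
apply: leq_trans (ltnW wssize).
(* No word from [power_langs t] is a factor, so only single letters occur and their number is the
   length of the whole word. *)
have size_ws : size (flatten ws) = size ws.
  rewrite size_flatten sumnE big_map -sum1_size.
  apply: eq_big_seq => w wws; have [L [[a ->] ->//|tL] Lw] := wsP w wws.
  by have := infix_power_langs i nst tL Lw; rewrite -e infix_flatten.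
rewrite -size_ws e size_power_word expnS mulnAC mulnC leq_pmulr //.
Qed.

Lemma power_langs_mono : transitive S leS -> forall s t, leS s t ->
  power_langs s `<=` power_langs t.
Proof.
by move=> tr s t st L [u [j [us ->]]]; exists u, j; split=> //; exact: tr us st.
Qed.

Lemma letter_power_langs_expressive P s t :
  leq_expr (lang_logic P (letter_power_langs s))
           (lang_logic P (letter_power_langs t)).
Proof.
apply: leq_expr_letters => [L [[a ->]|[u [j [_ ->]]]]|a].
- by exists [:: a].
- by exists (power_word (code u) j).
- by left; exists a.
Qed.

End Families.

Theorem theorem2 (R : realType) (P : Type) (infP : infinite_set [set: P])
    (S : Type) (countS : countable [set: S]) (leS : S -> S -> Prop)
    (ordS : Relation_Definitions.order S leS) :
  exists LL KK : S -> set (language 2), forall s t : S,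
    [/\ (leq_expr (lang_logic P (KK s)) (lang_logic P (KK t)) <->
           leq_poly R (lang_logic P (LL s)) (lang_logic P (LL t))) /\
        (leq_poly R (lang_logic P (LL s)) (lang_logic P (LL t)) <-> leS s t),
        equally_expressive (lang_logic P (LL s)) (lang_logic P (LL t)) &
        ~ leS s t ->
          exp_more_succinct R (lang_logic P (LL s)) (lang_logic P (LL t))].
Proof.
have [p _] : [set: P] !=set0.
  by apply/set0P/eqP => P0; apply: infP; rewrite P0.
have [code code_inj] : exists code : S -> nat, injective code.
  have /countable_injP[code inj] := countS.
  by exists code => x y; apply: inj; rewrite in_setT.
have [refl trans _] := ordS.
exists (letter_power_langs leS code), (power_langs leS code) => s t.
pose phi i := word_box (power_word (code s) i) (Var 2 p).
have phiK i : lang_logic P (power_langs leS code s) (phi i).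
  by apply: logic_word_box => //; exists s, i.
have phiL i : lang_logic P (letter_power_langs leS code s) (phi i).
  by apply: lang_logic_sub (phiK i) => L sL; right.
have KK_le : leq_expr (lang_logic P (power_langs leS code s))
    (lang_logic P (power_langs leS code t)) <-> leS s t.
  split=> [h|st]; last first.
    by apply/leq_expr_sub/lang_logic_sub; exact: power_langs_mono.
  apply: contrapT => nst; have [psi lpsi e] := h _ (phiK 0%N).
  exact: power_langs_inexpressible nst lpsi e.
have LL_le : leq_poly R (lang_logic P (letter_power_langs leS code s))
    (lang_logic P (letter_power_langs leS code t)) <-> leS s t.
  split=> [[q h]|st]; last first.
    apply/leq_poly_sub/lang_logic_sub => L [La|sL]; first by left.
    by right; apply: power_langs_mono sL.
  (* The formulas [phi i] all have size 2. *)
  apply: contrapT => nst; pose i := Num.bound `|q.[2%:R]|%R.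
  have [psi [lpsi e /=]] := h _ (phiL i).
  (* The size of [psi] is at least [2 ^ i > i], and [i] was chosen to exceed the supposed bound
     [q.[2]]. *)
  have := letter_power_langs_size code_inj nst lpsi e.
  move=> /(leq_trans (ltnW (ltn_expl i (ltnSn 1)))).
  rewrite -(ler_nat R) => ipsi psiq.
  have := le_trans ipsi psiq.
  by rewrite leNgt (le_lt_trans (ler_norm _)) // archi_boundP.
have eqexpr : equally_expressive (lang_logic P (letter_power_langs leS code s))
    (lang_logic P (letter_power_langs leS code t)).
  by split; exact: letter_power_langs_expressive.
split=> // [|nst]; first by split=> //; rewrite KK_le LL_le.
split=> //; exists (fun i => iter i.*2 (@Neg 2 P) (phi i)); split.
- by move=> i; rewrite /lang_logic logic_iter_neg; exact: phiL.
(* The padded formula has size [2 * i + 2], so the upper bound [2 * i.+1] is attained. *)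
- exists 2%N => i; rewrite fsize_iter_neg /= mulnDr -mul2n; split.
    by rewrite mulnA (leq_trans _ (leq_addr _ _)) // leq_pmull.
  by rewrite mulnS addnC.
- exists 2%:R%R; split; first by rewrite ltr1n.
  move=> i psi lpsi e; rewrite -natrX ler_nat.
  apply: (letter_power_langs_size code_inj nst lpsi (p := p)) => M x.
  by rewrite -(e M x) iter_double_neg.
Qed.
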